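(* Let $A, B\in \mathbb{C}^{m\times n}$ and let $r=\operatorname{rank}(A)$. Then the following are equivalent: (i) $A^*B=0$ (that is, $A$ is left $*$-orthogonal to $B$); (ii) there exist unitary matrices $U\in \mathbb{C}^{m\times m}$ and $V\in \mathbb{C}^{n\times n}$, and a nonsingular matrix $\Sigma\in\mathbb{C}^{r\times r}$ such that $$A=U\begin{bmatrix}\Sigma & 0\\ 0& 0\end{bmatrix}V^*,\qquad B=U\begin{bmatrix}0 & 0\\ B_3& B_4\end{bmatrix}V^*,$$ where $B_3\in \mathbb{C}^{(m-r)\times r}$ and $B_4\in \mathbb{C}^{(m-r)\times (n-r)}$. In this case (for any such decomposition), $$B^\dagger = V\begin{bmatrix}0 & B_3^*(B_3B_3^*+B_4B_4^* )^\dagger\\ 0 & B_4^*(B_3B_3^*+B_4B_4^* )^\dagger\end{bmatrix}U^*.$$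
   Context: $M^*$ denotes the conjugate transpose of $M$ and $M^\dagger$ its Moore-Penrose inverse, i.e. the unique matrix satisfying $MM^\dagger M=M$, $M^\dagger MM^\dagger=M^\dagger$, $(MM^\dagger)^*=MM^\dagger$, $(M^\dagger M)^*=M^\dagger M$. Blocks with zero rows or columns are allowed. *)

(* Defs.v *)
From HB Require Import structures.
From mathcomp Require Import all_boot all_order all_algebra.
From mathcomp Require Import sesquilinear spectral.
From mathcomp Require Import reals.
From mathcomp Require Import complex.
Set Implicit Arguments.
Unset Strict Implicit.
Unset Printing Implicit Defensive.
Import Order.TTheory GRing.Theory Num.Theory.
Local Open Scope ring_scope.
Local Open Scope sesquilinear_scope.

Section MoorePenrose.
Variable C : numClosedFieldType.

Lemma conjtrM m n p (M : 'M[C]_(m, n)) (N : 'M[C]_(n, p)) :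
  (M *m N)^t* = N^t* *m M^t*.
Proof. by rewrite trmx_mul map_mxM. Qed.

Definition is_mpinv m n (M : 'M[C]_(m, n)) (X : 'M[C]_(n, m)) : bool :=
  [&& M *m X *m M == M,
      X *m M *m X == X,
      (M *m X)^t* == M *m X
    & (X *m M)^t* == X *m M].

Lemma is_mpinv_uniq m n (M : 'M[C]_(m, n)) (X Y : 'M[C]_(n, m)) :
  is_mpinv M X -> is_mpinv M Y -> X = Y.
Proof.
case/and4P=> /eqP X1 /eqP X2 /eqP X3 /eqP X4.
case/and4P=> /eqP Y1 /eqP Y2 /eqP Y3 /eqP Y4.
have eMX : M *m X = M *m Y.
  have -> : M *m X = (M *m Y) *m (M *m X) by rewrite mulmxA Y1.
  by rewrite -{1}Y3 -{1}X3 -conjtrM mulmxA X1 Y3.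
have eXM : X *m M = Y *m M.
  have -> : X *m M = (X *m M) *m (Y *m M) by rewrite -mulmxA (mulmxA M) Y1.
  by rewrite -{1}Y4 -{1}X4 -conjtrM -mulmxA (mulmxA M) X1 Y4.
by rewrite -X2 eXM -mulmxA eMX mulmxA Y2.
Qed.

Lemma gram_unitmx m n (G : 'M[C]_(m, n)) :
  row_free G -> G *m G^t* \in unitmx.
Proof.
move=> Gfree; rewrite -row_free_unit -kermx_eq0.
apply/eqP/row_matrixP=> i; rewrite row0.
set v := row i _.
have vGG : v *m (G *m G^t*) = 0 by rewrite -row_mul mulmx_ker row0.
have vG0 : v *m G = 0.
  apply/eqP; apply: contraTT isT => /dotmx_is_dotmx.
  by rewrite dotmxE conjtrM -mulmxA (mulmxA G) (mulmxA v) vGG mul0mx mxE ltxx.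
by apply/eqP; rewrite -(mulmx_free_eq0 _ Gfree) vG0.
Qed.

Lemma ex_mpinv m n (M : 'M[C]_(m, n)) :
  exists X : 'M[C]_(n, m), is_mpinv M X.
Proof.
have := mulmx_base M; have := row_base_free M; have := col_base_full M.
move: (\rank M) (col_base M) (row_base M) => r F G Ffull Gfree <- {M}.
pose P := F^t* *m F; pose Q := G *m G^t*.
have uQ : Q \in unitmx by exact: gram_unitmx.
have uP : P \in unitmx.
  have := @gram_unitmx _ _ (F^t*); rewrite trmxCK; apply.
  by rewrite /row_free mxrank_map mxrank_tr.
have hP : P^t* = P by rewrite conjtrM trmxCK.
have hQ : Q^t* = Q by rewrite conjtrM trmxCK.
have hV k (N : 'M[C]_k) : N^t* = N -> (invmx N)^t* = invmx N.
  by move=> hN; rewrite trmx_inv map_invmx hN.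
exists (G^t* *m invmx Q *m invmx P *m F^t*).
have GX : G *m (G^t* *m invmx Q *m invmx P *m F^t*) = invmx P *m F^t*.
  by rewrite !mulmxA mulmxV // mul1mx.
have XF : G^t* *m invmx Q *m invmx P *m F^t* *m F = G^t* *m invmx Q.
  by rewrite -!mulmxA mulVmx // mulmx1.
have eFX : F *m G *m (G^t* *m invmx Q *m invmx P *m F^t*) =
    F *m invmx P *m F^t*.
  by rewrite -mulmxA GX mulmxA.
have eXF : G^t* *m invmx Q *m invmx P *m F^t* *m (F *m G) =
    G^t* *m invmx Q *m G.
  by rewrite mulmxA XF.
apply/and4P; split; apply/eqP.
- by rewrite eFX -!mulmxA (mulmxA _ F) (mulmxA (invmx P)) mulVmx // mul1mx.
- by rewrite eXF -!mulmxA (mulmxA G) (mulmxA Q) mulmxV // mul1mx.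
- by rewrite eFX !conjtrM trmxCK hV // mulmxA.
- by rewrite eXF !conjtrM trmxCK hV // mulmxA.
Qed.

Definition mpinv m n (M : 'M[C]_(m, n)) : 'M[C]_(n, m) :=
  xchoose (ex_mpinv M).

Lemma mpinvP m n (M : 'M[C]_(m, n)) : is_mpinv M (mpinv M).
Proof. exact: xchooseP. Qed.

Lemma mpinv_eq m n (M : 'M[C]_(m, n)) X : is_mpinv M X -> mpinv M = X.
Proof. exact/is_mpinv_uniq/mpinvP. Qed.

End MoorePenrose.

(* [r + (m - r)] is only propositionally equal to [m], hence the cast. *)
Definition blocks (C : numClosedFieldType) (m n r : nat)
    (le_rm : (r <= m)%N) (le_rn : (r <= n)%N)
    (M11 : 'M[C]_(r, r)) (M12 : 'M[C]_(r, n - r))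
    (M21 : 'M[C]_(m - r, r)) (M22 : 'M[C]_(m - r, n - r)) : 'M[C]_(m, n) :=
  castmx (subnKC le_rm, subnKC le_rn) (block_mx M11 M12 M21 M22).

Definition orth_decomp (C : numClosedFieldType) (m n : nat)
    (A B : 'M[C]_(m, n)) (U : 'M[C]_m) (V : 'M[C]_n)
    (Sigma : 'M[C]_(\rank A))
    (B3 : 'M[C]_(m - \rank A, \rank A))
    (B4 : 'M[C]_(m - \rank A, n - \rank A)) : Prop :=
  let blk := blocks (rank_leq_row A) (rank_leq_col A) in
  [/\ U \is unitarymx, V \is unitarymx, Sigma \in unitmx,
      A = U *m blk Sigma 0 0 0 *m V^t*
    & B = U *m blk 0 0 B3 B4 *m V^t*].
Arguments orth_decomp {C m n} A B U V Sigma B3 B4.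

(* Main.v *)
(** Take orthonormal bases of the column space and of the row space of [A] and
    complete them to unitary matrices [U] and [V]: in these bases [A] becomes
    [diag(Sigma, 0)], and [A^H B = 0] says that the columns of [B] are
    orthogonal to those of [A], i.e. that the top block row of [U^H B V]
    vanishes.  The pseudoinverse is invariant under unitary changes of bases,
    ignores zero rows, and satisfies [G^+ = G^H (G G^H)^+], where [^H] is the
    conjugate transpose. *)

Require Import Defs.
From HB Require Import structures.
From mathcomp Require Import all_boot all_order all_algebra.
From mathcomp Require Import sesquilinear spectral.
From mathcomp Require Import reals.
From mathcomp Require Import complex.
Set Implicit Arguments.
Unset Strict Implicit.
Unset Printing Implicit Defensive.
Import Order.TTheory GRing.Theory Num.Theory.
Local Open Scope ring_scope.
Local Open Scope sesquilinear_scope.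
Local Open Scope complex_scope.

Section ConjugateTranspose.
Variable C : numClosedFieldType.

Lemma conjtr0 m n : (0 : 'M[C]_(m, n))^t* = 0.
Proof. by rewrite trmx0 map_mx0. Qed.

Lemma conjtr_col_mx m1 m2 n (M : 'M[C]_(m1, n)) (N : 'M[C]_(m2, n)) :
  (col_mx M N)^t* = row_mx (M^t*) (N^t*).
Proof. by rewrite tr_col_mx map_row_mx. Qed.

Lemma conjtr_row_mx m n1 n2 (M : 'M[C]_(m, n1)) (N : 'M[C]_(m, n2)) :
  (row_mx M N)^t* = col_mx (M^t*) (N^t*).
Proof. by rewrite tr_row_mx map_col_mx. Qed.

Lemma conjtr_block_mx m1 m2 n1 n2 (Mul : 'M[C]_(m1, n1)) (Mur : 'M[C]_(m1, n2))
    (Mdl : 'M[C]_(m2, n1)) (Mdr : 'M[C]_(m2, n2)) :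
  (block_mx Mul Mur Mdl Mdr)^t* =
    block_mx (Mul^t*) (Mdl^t*) (Mur^t*) (Mdr^t*).
Proof. by rewrite tr_block_mx map_block_mx. Qed.

(** The hypothesis says that the row space of [M] is orthogonal to itself, and a subspace meets its
    orthogonal complement only in 0. *)
Lemma mulmx_conjtr_eq0 m n (M : 'M[C]_(m, n)) : M *m M^t* = 0 -> M = 0.
Proof.
move/orthomx1P/orthomx_disj=> M0; apply/eqP.
by rewrite -submx0 -M0 sub_capmx submx_refl.
Qed.

Lemma unitarymx_mulVmx n (U : 'M[C]_n) : U \is unitarymx -> U^t* *m U = 1%:M.
Proof. by move=> /unitarymxP/mulmx1C. Qed.

End ConjugateTranspose.

Section MoorePenroseBlocks.
Variable C : numClosedFieldType.

Lemma is_mpinv_conjtr m n (M : 'M[C]_(m, n)) (X : 'M[C]_(n, m)) :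
  is_mpinv M X -> is_mpinv (M^t*) (X^t*).
Proof.
case/and4P=> /eqP X1 /eqP X2 /eqP X3 /eqP X4; apply/and4P.
by split; apply/eqP; rewrite -!conjtrM ?mulmxA ?X1 ?X2 ?X3 ?X4.
Qed.

Lemma mpinv_hermitian n (M : 'M[C]_n) : M^t* = M -> (mpinv M)^t* = mpinv M.
Proof.
by move=> hM; apply/esym/mpinv_eq; rewrite -{1}hM; apply/is_mpinv_conjtr/mpinvP.
Qed.

(** Since [K] is Hermitian along with [H], all Penrose equations but the first follow from those of
    [K]. The first needs [H K G = G], obtained by positivity of the Gram matrix. *)
Lemma is_mpinv_gram m n (G : 'M[C]_(m, n)) :
  is_mpinv G (G^t* *m mpinv (G *m G^t*)).
Proof.
set H := G *m G^t*; set K := mpinv H.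
have hH : H^t* = H by rewrite conjtrM trmxCK.
have hK : K^t* = K by exact: mpinv_hermitian.
have /and4P[/eqP K1 /eqP K2 /eqP K3 _] : is_mpinv H K by exact: mpinvP.
have GX : G *m (G^t* *m K) = H *m K by rewrite mulmxA.
apply/and4P; split; apply/eqP.
- rewrite GX; apply/eqP; rewrite -subr_eq0; apply/eqP.
  (* With [E := H K G - G = (H K - 1) G] one has
     [E E^H = (H K - 1) H (H K - 1)^H = 0]. *)
  apply: mulmx_conjtr_eq0.
  have -> : H *m K *m G - G = (H *m K - 1%:M) *m G by rewrite mulmxBl mul1mx.
  rewrite conjtrM mulmxA -(mulmxA _ G) mulmxBl mul1mx K1.
  by rewrite subrr mul0mx.
- by rewrite -!mulmxA (mulmxA G) (mulmxA K) K2.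
- by rewrite GX.
- by rewrite !conjtrM trmxCK hK !mulmxA.
Qed.

(** The inner unitary factors cancel, so the two products are the unitary conjugates of [M X] by [U]
    and of [X M] by [V]. *)
Lemma is_mpinv_unitary m n (M : 'M[C]_(m, n)) (X : 'M[C]_(n, m))
    (U : 'M[C]_m) (V : 'M[C]_n) :
  U \is unitarymx -> V \is unitarymx -> is_mpinv M X ->
  is_mpinv (U *m M *m V^t*) (V *m X *m U^t*).
Proof.
move=> /unitarymx_mulVmx hU /unitarymx_mulVmx hV.
case/and4P=> /eqP X1 /eqP X2 /eqP X3 /eqP X4.
have eMX : U *m M *m V^t* *m (V *m X *m U^t*) = U *m (M *m X) *m U^t*.
  by rewrite !mulmxA -(mulmxA _ (V^t*)) hV mulmx1.
have eXM : V *m X *m U^t* *m (U *m M *m V^t*) = V *m (X *m M) *m V^t*.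
  by rewrite !mulmxA -(mulmxA _ (U^t*)) hU mulmx1.
apply/and4P; split; apply/eqP.
- by rewrite eMX !mulmxA -(mulmxA _ (U^t*)) hU mulmx1 -!(mulmxA U) X1.
- by rewrite eXM !mulmxA -(mulmxA _ (V^t*)) hV mulmx1 -!(mulmxA V) X2.
- by rewrite eMX !conjtrM trmxCK -conjtrM X3 mulmxA.
- by rewrite eXM !conjtrM trmxCK -conjtrM X4 mulmxA.
Qed.

Lemma is_mpinv_col0 p m n (G : 'M[C]_(m, n)) (X : 'M[C]_(n, m)) :
  is_mpinv G X -> is_mpinv (col_mx (0 : 'M_(p, n)) G) (row_mx 0 X).
Proof.
case/and4P=> /eqP X1 /eqP X2 /eqP X3 /eqP X4.
have eMX : col_mx (0 : 'M_(p, n)) G *m row_mx (0 : 'M_(n, p)) X =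
    block_mx 0 0 0 (G *m X).
  by rewrite mul_col_row !mul0mx mulmx0.
have eXM : row_mx (0 : 'M_(n, p)) X *m col_mx (0 : 'M_(p, n)) G = X *m G.
  by rewrite mul_row_col mul0mx add0r.
apply/and4P; split; apply/eqP.
- by rewrite eMX mul_block_col !mul0mx !add0r X1.
- by rewrite eXM mul_mx_row mulmx0 X2.
- by rewrite eMX conjtr_block_mx !conjtr0 X3.
- by rewrite eXM.
Qed.

End MoorePenroseBlocks.

Section OrthogonalDecomposition.
Variable C : numClosedFieldType.

(** Gram-Schmidt is applied to a basis of the row space of [A] and to one of its orthogonal
    complement. *)
Lemma orthonormal_completion k n r p (A : 'M[C]_(k, n)) :
  \rank A = r -> (r + p)%N = n ->
  exists (P : 'M[C]_(r, n)) (Q : 'M[C]_(p, n)),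
    [/\ col_mx P Q \is unitarymx, (P :=: A)%MS & A *m Q^t* = 0].
Proof.
move=> rA en; have := schmidt_complete_unitarymx A; rewrite /schmidt_complete.
set O := orthomx _ _ A => hW.
have eP : (schmidt (row_base A) :=: A)%MS.
  exact: eqmx_trans (eqmx_schmidt_free (row_base_free A)) (eq_row_base A).
have AQ : A *m (schmidt (row_base O))^t* = 0.
  apply/orthomx1P; rewrite orthomx_sym.
  by rewrite eqmx_schmidt_free ?row_base_free // eq_row_base.
have ep : \rank O = p by rewrite rank_ortho rA -en addKn.
(* Abstracting the two bases allows their dependent sizes to be rewritten to [r] and [p]. *)
move: (schmidt (row_base A)) (schmidt (row_base O)) hW eP AQ.
by rewrite rA ep => P Q *; exists P, Q.
Qed.

(* Taking [m] and [n] as variables with proofs of [r + p = m] and [r + q = n]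
   lets the casts of [blocks] be eliminated. *)
Lemma left_orthogonal_decomposition m n r p q
    (em : (r + p)%N = m) (en : (r + q)%N = n) (A B : 'M[C]_(m, n)) :
  \rank A = r -> A^t* *m B = 0 ->
  exists (U : 'M[C]_m) (V : 'M[C]_n) (S : 'M[C]_r)
         (B3 : 'M[C]_(p, r)) (B4 : 'M[C]_(p, q)),
    [/\ U \is unitarymx, V \is unitarymx, S \in unitmx,
        A = U *m castmx (em, en) (block_mx S 0 0 0) *m V^t*
      & B = U *m castmx (em, en) (block_mx 0 0 B3 B4) *m V^t*].
Proof.
case: _ / em A B => A B; case: _ / en A B => A B rA AB0.
(* The row space of [A] will give [V]; the row space of [A^H], that is the column space of [A] up to
   adjoint, will give [U]. *)
have [P [Q [PQu eP AQ]]] := orthonormal_completion rA erefl.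
have rA' : \rank (A^t*) = r by rewrite mxrank_map mxrank_tr.
have [P' [Q' [PQu' eP' AQ']]] := orthonormal_completion rA' erefl.
have Q'A : Q' *m A = 0.
  by rewrite -[LHS]trmxCK conjtrM AQ' conjtr0.
have P'B : P' *m B = 0.
  (* The rows of [P'] are combinations of those of [A^H], which annihilate [B]. *)
  have /submxP[D ->] : (P' <= A^t*)%MS by rewrite eP'.
  by rewrite -mulmxA AB0 mulmx0.
have conjK (M : 'M[C]_(r + p, r + q)) :
    M = (col_mx P' Q')^t* *m (col_mx P' Q' *m M *m (col_mx P Q)^t*)
          *m col_mx P Q.
  rewrite !mulmxA unitarymx_mulVmx // mul1mx.
  by rewrite -mulmxA unitarymx_mulVmx ?mulmx1.
have eA : col_mx P' Q' *m A *m (col_mx P Q)^t* =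
    block_mx (P' *m A *m P^t*) 0 0 0.
  rewrite mul_col_mx conjtr_col_mx mul_col_row Q'A !mul0mx.
  by rewrite -(mulmxA _ _ (Q^t*)) AQ mulmx0.
have eB : col_mx P' Q' *m B *m (col_mx P Q)^t* =
    block_mx 0 0 (Q' *m B *m P^t*) (Q' *m B *m Q^t*).
  by rewrite mul_col_mx conjtr_col_mx mul_col_row P'B !mul0mx.
exists ((col_mx P' Q')^t*), ((col_mx P Q)^t*), (P' *m A *m P^t*).
exists (Q' *m B *m P^t*), (Q' *m B *m Q^t*).
rewrite !castmx_id !trmxC_unitary trmxCK -eA -eB; split=> //.
(* [S] has full rank: [A] is a product with middle factor [diag(S, 0)], so
   [r = rank A <= rank S]. *)
rewrite -row_free_unit /row_free eqn_leq rank_leq_row /=.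
rewrite -{1}rA [A in (\rank A <= _)%N]conjK eA.
apply: leq_trans (mxrankM_maxl _ _) _; apply: leq_trans (mxrankM_maxr _ _) _.
by rewrite rank_diag_block_mx mxrank0 addn0.
Qed.

Lemma left_orthogonal_of_decomposition m n r p q
    (em : (r + p)%N = m) (en : (r + q)%N = n) (A B : 'M[C]_(m, n))
    (U : 'M[C]_m) (V : 'M[C]_n) (S : 'M[C]_r)
    (B3 : 'M[C]_(p, r)) (B4 : 'M[C]_(p, q)) :
  U \is unitarymx ->
  A = U *m castmx (em, en) (block_mx S 0 0 0) *m V^t* ->
  B = U *m castmx (em, en) (block_mx 0 0 B3 B4) *m V^t* ->
  A^t* *m B = 0.
Proof.
case: _ / em A B U => A B U; case: _ / en A B V => A B V.
move=> /unitarymx_mulVmx hU -> ->; rewrite !castmx_id !conjtrM trmxCK.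
rewrite !mulmxA -(mulmxA _ (U^t*)) hU mulmx1 -(mulmxA V).
rewrite conjtr_block_mx !conjtr0 mulmx_block !mul0mx !mulmx0 !addr0.
by rewrite block_mx_const mulmx0 mul0mx.
Qed.

(** With [G = [B3 B4]], the sum inside [K] is [G G^H], and the candidate is [G^H K] preceded by zero
    columns. *)
Lemma is_mpinv_lower_blocks m n r p q
    (em : (r + p)%N = m) (en : (r + q)%N = n)
    (B3 : 'M[C]_(p, r)) (B4 : 'M[C]_(p, q)) :
  let K := mpinv (B3 *m B3^t* + B4 *m B4^t*) in
  is_mpinv (castmx (em, en) (block_mx 0 0 B3 B4))
    (castmx (en, em) (block_mx 0 (B3^t* *m K) 0 (B4^t* *m K))).
Proof.
case: _ / em; case: _ / en; cbv zeta; set K := mpinv _; rewrite !castmx_id.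
have := is_mpinv_col0 r (is_mpinv_gram (row_mx B3 B4)).
rewrite conjtr_row_mx mul_row_col mul_col_mx -/K.
by rewrite block_mxEv row_mx0 block_mxEh col_mx0.
Qed.

End OrthogonalDecomposition.

Theorem theorem2p7 (R : realType) (m n : nat) (A B : 'M[R[i]]_(m, n)) :
  (A^t* *m B = 0 <->
   exists (U : 'M[R[i]]_m) (V : 'M[R[i]]_n) (Sigma : 'M[R[i]]_(\rank A))
          (B3 : 'M[R[i]]_(m - \rank A, \rank A))
          (B4 : 'M[R[i]]_(m - \rank A, n - \rank A)),
     orth_decomp A B U V Sigma B3 B4)
  /\
  (forall (U : 'M[R[i]]_m) (V : 'M[R[i]]_n) (Sigma : 'M[R[i]]_(\rank A))
          (B3 : 'M[R[i]]_(m - \rank A, \rank A))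
          (B4 : 'M[R[i]]_(m - \rank A, n - \rank A)),
     orth_decomp A B U V Sigma B3 B4 ->
     let K := mpinv (B3 *m B3^t* + B4 *m B4^t*) in
     mpinv B =
       V *m blocks (rank_leq_col A) (rank_leq_row A)
              0 (B3^t* *m K)
              0 (B4^t* *m K)
         *m U^t*).
Proof.
split; first split.
- move=> AB0; have [U [V [S [B3 [B4 dec]]]]] :=
    left_orthogonal_decomposition (subnKC (rank_leq_row A))
      (subnKC (rank_leq_col A)) erefl AB0.
  by exists U, V, S, B3, B4.
- case=> U [V [S [B3 [B4 [Uu Vu _ eA eB]]]]].
  exact: left_orthogonal_of_decomposition Uu eA eB.
move=> U V S B3 B4 [Uu Vu _ _ eB] K.
(* By uniqueness, it suffices that the right-hand side satisfies the Penrose equations. *)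
apply: mpinv_eq; rewrite {1}eB; apply: is_mpinv_unitary => //.
exact: is_mpinv_lower_blocks.
Qed.
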